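(* Let $\alpha\in(0,\frac12]$, $\kappa=(\frac12)^{2-\alpha}$, $\gamma=\frac{4-2\kappa}{1-\kappa}$, and let $Z$ be the limit process. Then, almost surely, $$\sqrt{\frac{2\gamma\log2}{\log(1/\kappa)}}\le\limsup_{h\downarrow0}\ \sup_{t,s\in[0,1],\ d_\kappa(t,s)=h}\frac{|Z(t)-Z(s)|}{\sqrt{h\log(1/h)}}\le\frac{2\sqrt{2\log2}}{\sqrt{\log(1/\kappa)}\,(1-\sqrt\kappa)},$$ where the $\limsup$ is taken over sequences $h\downarrow0$ with $h=\kappa^n$ for some $n\in\mathbb{N}$.
   Context: Binary expansions: each $t\in[0,1)$ is written in binary as $t=\sum_{i\ge1}t_i2^{-i}$, $t_i\in\{0,1\}$, using the expansion in which $t_i=0$ for infinitely many $i$; and $1=\sum_{i\ge 1}2^{-i}$. For $u,v\in[0,1]$, $j(u,v):=\max\{j\ge1:(u_1,\dots,u_j)=(v_1,\dots,v_j)\}$ with $\max\emptyset:=0$, $\max\mathbb{N}:=\infty$. The metric $d_\kappa$ on $[0,1]$ is $d_\kappa(x,y):=\kappa^{j(x,y)}$, with $\kappa^\infty:=0$. Limit process: let $\Theta:=\bigcup_{k\ge0}\{0,1\}^k$ be the set of finite $0$-$1$ words, $|\vartheta|$ the length of $\vartheta$, and $B_\vartheta\subset[0,1]$ the set of numbers whose binary expansion has prefix $\vartheta$. Let $\{N_\vartheta:\vartheta\in\Theta\}$ be independent standard normal random variables and, for $n\ge0$, $t\in[0,1]$, $$Z_n(t):=\sum_{\vartheta\in\Theta:\,|\vartheta|<n}\left(\tfrac12\right)^{(1-\alpha/2)|\vartheta|}\left(\mathbf{1}_{\{t\in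 B_{\vartheta0}\}}-\mathbf{1}_{\{t\in B_{\vartheta1}\}}\right)N_\vartheta .$$ The limit process $Z$ is the almost sure uniform limit of $(Z_n)_{n\ge0}$ on $[0,1]$ (this limit exists). *)

(* Defs.v *)
From HB Require Import structures.
From mathcomp Require Import all_boot all_order all_algebra.
From mathcomp Require Import all_classical all_reals all_analysis.

Set Implicit Arguments.
Unset Strict Implicit.
Unset Printing Implicit Defensive.

Import Order.TTheory GRing.Theory Num.Theory numFieldNormedType.Exports.

Local Open Scope classical_set_scope.
Local Open Scope ring_scope.

(* Digits are indexed from 0: [e i] is the digit of weight 2^-(i+1).
   For t = 1 the series condition alone forces all digits to be 1. *)
Definition is_binexp (R : realType) (t : R) (e : nat -> bool) : Prop :=
  (series (fun i => (e i)%:R * (2^-1 : R) ^+ i.+1) @ \oo --> t) /\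
  (t < 1 -> infinite_set [set i | ~~ e i]).

(* The default value is only used outside [0, 1], see [binexpP]. *)
Definition binexp (R : realType) (t : R) : nat -> bool :=
  xget (fun=> false) [set e | is_binexp t e].

Definition binprefix (R : realType) (t : R) (k : nat) : seq bool :=
  mkseq (binexp t) k.

Definition Bword (R : realType) (w : seq bool) : set R :=
  [set t | t \in `[0, 1] /\ binprefix t (size w) = w].

Definition agree (R : realType) (u v : R) : set nat :=
  [set j | (1 <= j)%N /\ binprefix u j = binprefix v j].

(* [None] encodes the value oo; [supremum 0 set0 = 0], and a nonempty set
   [agree u v] other than {1, 2, ...} is finite, with supremum its maximum. *)
Definition jcommon (R : realType) (u v : R) : option nat :=
  if agree u v == [set j | (1 <= j)%N] then None
  else Some (supremum 0%N (agree u v)).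

Definition dkappa (R : realType) (kappa x y : R) : R :=
  if jcommon x y is Some j then kappa ^+ j else 0.

Section process.
Context d (T : measurableType d) (R : realType) (P : probability T R).

Definition mutually_independent (I : choiceType) (X : I -> {RV P >-> R}) :=
  forall (s : seq I) (A : I -> set R), uniq s ->
    (forall i, measurable (A i)) ->
    P (\bigcap_(i in [set` s]) (X i @^-1` A i)) =
    (\prod_(i <- s) P (X i @^-1` A i))%E.

Definition standard_normal (X : {RV P >-> R}) :=
  forall A : set R, measurable A -> distribution P X A = normal_prob 0 1 A.

Definition Zn (alpha : R) (N : seq bool -> {RV P >-> R}) (n : nat) (x : T)
    (t : R) : R :=
  \sum_(k < n) \sum_(w : k.-tuple bool)
    (2^-1 `^ ((1 - alpha / 2) * (size w)%:R)) *
    (\1_(Bword (R := R) (rcons w false)) t - \1_(Bword (rcons w true)) t) *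
    N w x.

(* [Z x t] is the value at time t of the path of the outcome x. *)
Definition is_limit_process (alpha : R) (N : seq bool -> {RV P >-> R})
    (Z : T -> R -> R) : Prop :=
  {ae P, forall x,
    {uniform `[0, 1]%classic, (fun n => Zn alpha N n x) @ \oo --> Z x}}.

End process.

Definition modulus_ratio (R : realType) (kappa : R) (f : R -> R) (h : R) :
    \bar R :=
  ereal_sup [set r | exists t s : R,
    [/\ t \in `[0, 1], s \in `[0, 1], dkappa kappa t s = h &
        r = (`|f t - f s| / Num.sqrt (h * ln (h^-1)))%:E]].

(* h tends to 0 from the right along the powers of kappa. *)
Definition kappa_powers_to_0 (R : realType) (kappa : R) : set_system R :=
  within [set kappa ^+ n | n in [set: nat]] 0^'+.

Section binexp_exists.
Variable R : realType.
Implicit Types (t : R) (e : nat -> bool).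

Let S e n : R := series (fun i => (e i)%:R * (2^-1 : R) ^+ i.+1) n.

Let SS e n : S e n.+1 = S e n + (e n)%:R * (2^-1) ^+ n.+1.
Proof. by rewrite /S seriesSr. Qed.

Let S_ones e m n : (forall i, (m <= i)%N -> e i) ->
  S e (m + n) + 2^-1 ^+ (m + n) = S e m + 2^-1 ^+ m.
Proof.
move=> em; elim: n => [|n IHn]; first by rewrite addn0.
rewrite addnS SS em ?leq_addr// -IHn exprS mul1r -addrA; congr (_ + _).
by rewrite -mulrDl -[X in X + X]mul1r -splitr mul1r.
Qed.

Let half_cvg : (2^-1 : R) ^+ n @[n --> \oo] --> (0 : R).
Proof. by apply: cvg_expr; rewrite ger0_norm ?invr_ge0// invf_lt1// ltr1n. Qed.

Let S_ones_cvg e m : (forall i, (m <= i)%N -> e i) ->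
  S e @ \oo --> S e m + 2^-1 ^+ m.
Proof.
move=> em; rewrite -(cvg_shiftn m).
have -> : (fun n => S e (n + m)) =
    (fun n => S e m + 2^-1 ^+ m - (2^-1 : R) ^+ (n + m)).
  by apply/funext => n; rewrite -(S_ones n em) addnC addrK.
have h0 : (fun n => (2^-1 : R) ^+ (n + m)) @ \oo --> (0 : R).
  by rewrite (cvg_shiftn m (fun n => (2^-1 : R) ^+ n)).
by have := cvgB (cvg_cst (S e m + 2^-1 ^+ m)) h0; rewrite subr0; apply.
Qed.

Lemma is_binexp_ex t : t \in `[0, 1] -> exists e, is_binexp t e.
Proof.
rewrite in_itv/= => /andP[t0]; rewrite le_eqVlt => /orP[/eqP->|t1].
  exists (fun=> true); split; last by rewrite ltxx.
  by have := @S_ones_cvg (fun=> true) 0%N (fun _ _ => isT);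
     rewrite /S /series/= big_geq// expr0 add0r.
pose c n := Num.truncn (t * 2 ^+ n).
pose e i := odd (c i.+1).
have c_itv n : (c n)%:R <= t * 2 ^+ n < (c n).+1%:R.
  by apply: truncn_itv; rewrite mulr_ge0// exprn_ge0.
have cS n : c n.+1 = (e n + (c n).*2)%N.
  suff cE : (c n.+1)./2 = c n by rewrite -cE /e odd_double_half.
  apply/eqP; rewrite eqn_leq -ltnS -[X in _ && X]ltnS.
  have /andP[l1 u1] := c_itv n; have /andP[l2 u2] := c_itv n.+1.
  have tE : t * 2 ^+ n.+1 = (t * 2 ^+ n) * 2 by rewrite exprSr mulrA.
  rewrite tE in l2 u2.
  apply/andP; split; rewrite -ltn_double -(ltr_nat R).
    apply: (@le_lt_trans _ _ (c n.+1)%:R).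
      by rewrite ler_nat -[leqRHS]odd_double_half leq_addl.
    apply: (le_lt_trans l2).
    by rewrite -muln2 natrM ltr_pM2r.
  apply: (@le_lt_trans _ _ (t * 2 ^+ n * 2)).
    by rewrite -muln2 natrM ler_pM2r.
  apply: (lt_le_trans u2); rewrite ler_nat doubleS ltnS.
  by rewrite -[leqLHS]odd_double_half -[leqRHS]add1n leq_add2r leq_b1.
have SE n : S e n = (c n)%:R / 2 ^+ n.
  elim: n => [|n IHn].
    have /andP[l _] := c_itv 0%N.
    have -> : c 0%N = 0%N.
      apply/eqP; rewrite -leqn0 -ltnS -(ltr_nat R); apply: (le_lt_trans l).
      by rewrite expr0 mulr1.
    by rewrite mul0r /S /series/= big_geq.
  rewrite SS IHn cS natrD mulrDl addrC exprVn; congr (_ + _).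
  by rewrite -muln2 natrM exprSr invfM mulrACA divff ?mulr1.
have S_lb n : t < S e n + 2^-1 ^+ n.
  have /andP[_ u] := c_itv n.
  by rewrite SE exprVn -[X in _ + X]mul1r -mulrDl natr1 ltr_pdivlMr// exprn_gt0.
have S_ub n : S e n <= t.
  have /andP[l _] := c_itv n.
  by rewrite SE ler_pdivrMr// exprn_gt0.
exists e; split.
  apply: (@squeeze_cvgr _ _ _ _ (fun n => t - 2^-1 ^+ n) (fun=> t)).
  - by apply: nearW => n; rewrite [X in _ && X]S_ub andbT lerBlDr; exact/ltW/S_lb.
  - by have := cvgB (cvg_cst t) half_cvg; rewrite subr0; apply.
  - exact: cvg_cst.
move=> _ fin; have [m em] : exists m, forall i, (m <= i)%N -> e i.
  have /finite_seqP[s sE] := fin.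
  exists (\max_(i <- s) i).+1 => i mi.
  apply: contraLR mi => nei; rewrite -leqNgt.
  have si : i \in s by have : [set` s] i by rewrite -sE.
  exact: (@leq_bigmax_seq _ s xpredT id).
have /cvg_lim E := S_ones_cvg em.
have : S e m + 2^-1 ^+ m <= t.
  rewrite -E//; apply: limr_le; first by apply/cvg_ex; exists (S e m + 2^-1 ^+ m); exact: S_ones_cvg.
  exact: nearW.
by rewrite leNgt S_lb.
Qed.

Lemma binexpP t : t \in `[0, 1] -> is_binexp t (binexp t).
Proof. by move=> /is_binexp_ex[e te]; rewrite /binexp; case: xgetP => [_ ->|/(_ e)]. Qed.

End binexp_exists.

(* Main.v *)
Require Import Defs.
From HB Require Import structures.
From mathcomp Require Import all_boot all_order all_algebra.
From mathcomp Require Import all_classical all_reals all_analysis.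
From mathcomp Require Import measurable_realfun ring lra.
Set Implicit Arguments.
Unset Strict Implicit.
Unset Printing Implicit Defensive.
Import Order.TTheory GRing.Theory Num.Theory numFieldNormedType.Exports.
Local Open Scope classical_set_scope.
Local Open Scope ring_scope.

(** Put [a = sqrt kappa]. Two points at distance [kappa^n] share exactly their
    first [n] binary digits, so [Z t - Z s] only involves the normal variables
    indexed by words of length at least [n], a word of length [k] having
    weight [a^k].

    Upper bound: by Borel-Cantelli, almost surely [|N_w| <= c sqrt |w|] for all
    long words as soon as [c^2 > 2 ln 2]; summing the geometric series
    [a^k sqrt k] over [k >= n] along both points gives the constant.

    Lower bound: for a word [w] of length [n], the increment between [w000...]
    and [w100...] is, up to a tail, [a^n] times a combination of independent
    normal variables with coefficients [x_v], the sum of the [x_v^2] being close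
    to [gamma]. It exceeds [y * sum x_v^2] when each variable exceeds [x_v y];
    by independence this has probability at least
    [exp (- sum x_v^2 y^2 / 2 - O(y))], which is the right order, without
    computing the law of the combination. For [y^2 = 2 n ln 2 / gamma] this is
    much larger than [2^-n], and the [2^n] words of length [n] give independent
    trials, so that some word succeeds for infinitely many [n]. *)

(** * Binary expansions *)

Section binary_expansions.
Variable R : realType.
Implicit Types (t s : R) (e : nat -> bool) (w : seq bool).

Definition bin_series e : R^nat :=
  series (fun i => (e i)%:R * (2^-1 : R) ^+ i.+1).

Lemma bin_seriesS e n :
  bin_series e n.+1 = bin_series e n + (e n)%:R * 2^-1 ^+ n.+1.
Proof. by rewrite /bin_series seriesSr. Qed.

Lemma bin_series0 e : bin_series e 0 = 0.
Proof. by rewrite /bin_series /series/= big_geq. Qed.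

Lemma bin_seriesD_le e n k : bin_series e n <= bin_series e (n + k)%N.
Proof.
elim: k => [|k IH]; first by rewrite addn0.
by rewrite addnS bin_seriesS (le_trans IH)// lerDl mulr_ge0// exprn_ge0.
Qed.

Lemma half_exprS n : (2^-1 : R) ^+ n = 2^-1 ^+ n.+1 + 2^-1 ^+ n.+1.
Proof. by rewrite exprS -mulrDl -[X in X + X]mul1r -splitr mul1r. Qed.

(** The left side is the right end of the dyadic interval determined by [n + k] digits, and these
    intervals are nested. *)
Lemma bin_series_remainder_le e n k :
  bin_series e (n + k)%N + 2^-1 ^+ (n + k)%N <= bin_series e n + 2^-1 ^+ n.
Proof.
elim: k => [|k IH]; first by rewrite addn0.
rewrite (le_trans _ IH)// addnS bin_seriesS [in leRHS]half_exprS -addrA lerD2l.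
by rewrite lerD2r ler_piMl ?exprn_ge0// lern1 leq_b1.
Qed.

Lemma bin_series_lb t e n : bin_series e @ \oo --> t -> bin_series e n <= t.
Proof.
move=> et; rewrite -(cvg_lim _ et)//; apply: limr_ge.
  by apply/cvg_ex; exists t.
by near=> k; rewrite -(@subnKC n k) ?bin_seriesD_le//; near: k; exists n.
Unshelve. all: by end_near. Qed.

Lemma bin_series_ub t e n : bin_series e @ \oo --> t ->
  infinite_set [set i | ~~ e i] -> t < bin_series e n + 2^-1 ^+ n.
Proof.
move=> et einf.
have ub k : t <= bin_series e k + 2^-1 ^+ k.
  rewrite -(cvg_lim _ et)//; apply: limr_le; first by apply/cvg_ex; exists t.
  near=> l; rewrite -(@subnKC k l); last by near: l; exists k.
  by rewrite (le_trans _ (bin_series_remainder_le e k (l - k)))// lerDl exprn_ge0.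
(* A zero digit at [i] selects the left half of its dyadic interval, so the right end drops strictly
   there. *)
have [i ni ei] : exists2 i, (n <= i)%N & ~~ e i.
  apply: contrapT => H; apply: einf; apply: (@sub_finite_set _ _ `I_n).
    by move=> i /= ei; rewrite ltnNge; apply/negP => ni; apply: H; exists i.
  exact: finite_II.
apply: (@lt_le_trans _ _ (bin_series e i + 2^-1 ^+ i)).
  rewrite (le_lt_trans (ub i.+1))// bin_seriesS (negbTE ei) mul0r addr0.
  by rewrite ltrD2l [ltRHS]half_exprS ltrDl exprn_gt0.
by rewrite -{1 2}(subnKC ni) bin_series_remainder_le.
Unshelve. all: by end_near. Qed.

(** The first [n] digits confine [t] to a half-open dyadic interval whose two disjoint halves
    correspond to the values of digit [n]; so the digits agree one after the other. *)
Lemma is_binexp_inj t e e' : t < 1 ->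
  is_binexp t e -> is_binexp t e' -> e = e'.
Proof.
move=> t1 [et /(_ t1) einf] [e't /(_ t1) e'inf].
suff H : forall n, e n = e' n /\ bin_series e n = bin_series e' n.
  by apply/funext => n; case: (H n).
have dig n : bin_series e n = bin_series e' n -> e n = e' n.
  move=> E.
  have := bin_series_lb n.+1 et; have := bin_series_lb n.+1 e't.
  have := bin_series_ub n.+1 et einf; have := bin_series_ub n.+1 e't e'inf.
  rewrite !bin_seriesS E; case: (e n); case: (e' n) => //; rewrite mul1r mul0r addr0.
    by move=> + _ _ => /lt_le_trans/[apply]; rewrite ltxx.
  by move=> _ + + _ => /lt_le_trans/[apply]; rewrite ltxx.
elim=> [|n [ee ss]].
  have E0 : bin_series e 0 = bin_series e' 0 by rewrite !bin_series0.
  by split=> //; exact: dig.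
have ES : bin_series e n.+1 = bin_series e' n.+1 by rewrite !bin_seriesS ee ss.
by split=> //; exact: dig.
Qed.

(** The point with digits [w] followed by zeros, which the default value of [nth] supplies. *)
Definition word_point w : R := bin_series (nth false w) (size w).

Lemma bin_series_word_point w k :
  bin_series (nth false w) (size w + k)%N = word_point w.
Proof.
elim: k => [|k IH]; first by rewrite addn0.
by rewrite addnS bin_seriesS IH nth_default ?leq_addr// mul0r addr0.
Qed.

Lemma word_point_ge0 w : 0 <= word_point w.
Proof.
by have := bin_seriesD_le (nth false w) 0 (size w); rewrite bin_series0 add0n.
Qed.

Lemma word_point_lt1 w : word_point w < 1.
Proof.
have := bin_series_remainder_le (nth false w) 0 (size w).
rewrite bin_series0 add0n add0r expr0; apply: lt_le_trans.
by rewrite ltrDl exprn_gt0.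
Qed.

Lemma word_point_itv w : word_point w \in `[0, 1].
Proof. by rewrite in_itv/= word_point_ge0 ltW// word_point_lt1. Qed.

Lemma binexp_word_point w : binexp (word_point w) = nth false w.
Proof.
apply: (is_binexp_inj (word_point_lt1 w)); first exact/binexpP/word_point_itv.
split.
  have : bin_series (nth false w) @ \oo --> word_point w; last by [].
  rewrite -(cvg_shiftn (size w)).
  rewrite (_ : (fun n => _) = fun=> word_point w); first exact: cvg_cst.
  by apply/funext => n; rewrite addnC bin_series_word_point.
move=> _; apply: (@sub_infinite_set _ (~` `I_(size w))).
  by move=> i /= /negP; rewrite -leqNgt => wi; rewrite nth_default.
by rewrite -setTD; apply: infinite_setD; [exact: infinite_nat|exact: finite_II].
Qed.

End binary_expansions.

(** * Common prefixes and the metric *)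

Section common_prefix.
Variable R : realType.
Implicit Types (t s : R).

Lemma binprefix_leq t s i j : (i <= j)%N ->
  binprefix t j = binprefix s j -> binprefix t i = binprefix s i.
Proof.
move=> ij /(congr1 (take i)); rewrite /binprefix /mkseq -!map_take !take_iota.
by rewrite (minn_idPl ij).
Qed.

Lemma jcommon_binprefix t s n : (0 < n)%N ->
  jcommon t s = Some n -> binprefix t n = binprefix s n.
Proof.
rewrite /jcommon; case: ifPn => // /eqP agN n0 [supn].
have [j [j0 /= jag]] : exists j, (1 <= j)%N /\ ~ agree t s j.
  apply: contrapT => H; apply: agN; apply/seteqP; split => [j []//|j /= j0].
  by apply: contrapT => jN; apply: H; exists j.
have ubj : ubound (agree t s) j.
  move=> i [_ iag]; rewrite leNgt; apply/negP => ji; apply: jag; split=> //.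
  by apply: binprefix_leq iag; exact: ltnW.
(* Here [n0] rules out the default value 0 that [supremum] takes on the empty set. *)
move: supn; rewrite /supremum; case: ifPn => [_ n0'|ag0].
  by rewrite -n0' in n0.
case: xgetP => [k -> [ubk lbk] kn|+ _]; last first.
  have [k supk] := nat_supremums_neq0 (ex_intro _ j ubj).
  by move/(_ k).
rewrite {}kn in ubk lbk.
(* If the prefixes of length [n] differed, [n.-1] would be a smaller upper bound. *)
apply: contrapT => nag.
have : (n <= n.-1)%O.
  apply: lbk => i agi; have iN : (i <= n)%N by exact: ubk.
  have : (i < n)%N.
    rewrite ltn_neqAle iN andbT; apply/eqP => iEn.
    by apply: nag; rewrite -iEn; case: agi.
  by rewrite -{1}(prednK n0) ltnS.
by apply/negP; rewrite leEnat -ltnNge prednK.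
Qed.

Lemma jcommon_first_diff t s n : binprefix t n = binprefix s n ->
  binexp t n != binexp s n -> jcommon t s = Some n.
Proof.
move=> tsn tsn'.
have agP j : agree t s j -> (j <= n)%N.
  move=> [_ jag]; rewrite leqNgt; apply/negP => nj.
  have := binprefix_leq nj jag => /(congr1 (nth false ^~ n)).
  by rewrite !nth_mkseq//; exact/eqP.
rewrite /jcommon ifF; last first.
  by apply/negP => /eqP agE; have := agP n.+1; rewrite agE ltnn; move/(_ isT).
congr Some; case: n => [|n] in tsn tsn' agP *.
  rewrite [agree t s](_ : _ = set0) ?supremum0//.
  apply/seteqP; split => // j agj; have := agP _ agj.
  by case: agj; case: j.
have sup : supremums (agree t s) n.+1.
  by split => [j /agP//|j ubj]; apply: ubj.
have agn : agree t s n.+1 by [].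
rewrite /supremum ifF; last by apply/negP => /eqP ag0; rewrite ag0 in agn.
by case: xgetP => [k _ /is_subset1_supremums|/(_ n.+1)//]; apply.
Qed.

Lemma dkappa_binprefix (kappa t s : R) n : 0 < kappa < 1 -> (0 < n)%N ->
  dkappa kappa t s = kappa ^+ n -> binprefix t n = binprefix s n.
Proof.
move=> /andP[k0 k1] n0; rewrite /dkappa; case E : (jcommon t s) => [j|].
  move=> kjn; apply: jcommon_binprefix => //; rewrite E; congr Some.
  apply/eqP; move/eqP: kjn; rewrite eq_le !ler_iXn2l//.
  by rewrite -eqn_leq eq_sym.
by move/esym/eqP; rewrite expf_eq0 n0 gt_eqF.
Qed.

Lemma dkappa_first_diff (kappa t s : R) n : binprefix t n = binprefix s n ->
  binexp t n != binexp s n -> dkappa kappa t s = kappa ^+ n.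
Proof. by move=> tsn tsn'; rewrite /dkappa (jcommon_first_diff tsn tsn'). Qed.

Lemma indic_Bword_rcons t w b : t \in `[0, 1] ->
  \1_(Bword (R := R) (rcons w b)) t =
  ((binprefix t (size w) == w) && (binexp t (size w) == b))%:R :> R.
Proof.
move=> t01; rewrite indicE; congr (_%:R); congr nat_of_bool.
have -> : (t \in Bword (rcons w b)) = (binprefix t (size w).+1 == rcons w b).
  apply/idP/eqP; rewrite inE /Bword/= size_rcons; first by case.
  by split.
by rewrite /binprefix mkseqS eqseq_rcons.
Qed.

End common_prefix.

(** * Increments of a path *)

Section walks.
Variables (R : realType) (a : R) (g : seq bool -> R).
Implicit Types (e : nat -> bool) (w : seq bool).

(** With [g] the normal variables and [e] the digits of [t], this is the contribution of level [k]
    to the series at [t]; the sign is the difference of the two indicators. *)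
Definition walk_step e k : R := a ^+ k * (-1) ^+ (e k) * g (mkseq e k).

Definition walk e n : R := \sum_(0 <= k < n) walk_step e k.

Lemma walk_sub_agree e e' n M : (n <= M)%N -> mkseq e n = mkseq e' n ->
  walk e M - walk e' M =
  \sum_(n <= k < M) walk_step e k - \sum_(n <= k < M) walk_step e' k.
Proof.
move=> nM ee'; rewrite /walk !(big_cat_nat (n := n) (leq0n n) nM)/=.
rewrite (_ : \sum_(0 <= k < n) walk_step e k = \sum_(0 <= k < n) walk_step e' k).
  by rewrite opprD addrACA subrr add0r.
apply: eq_big_nat => k /andP[_ kn]; rewrite /walk_step.
have eek : mkseq e k = mkseq e' k.
  move/(congr1 (take k)): ee'; rewrite /mkseq -!map_take !take_iota.
  by rewrite (minn_idPl (ltnW kn)).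
move/(congr1 (nth false ^~ k)): ee'; rewrite !nth_mkseq// => ->.
by rewrite eek.
Qed.

(** For [k >= n], passing from [k] to [k + 1] multiplies [a ^+ k * sqrt k] by at most
    [a * (1 + 1/n)], so a geometric sequence of ratio [q] dominates. *)
Lemma exprM_sqrt_le (q : R) n j :
  0 <= a -> (0 < n)%N -> a * (1 + n%:R^-1) <= q ->
  a ^+ (n + j) * Num.sqrt (n + j)%:R <= a ^+ n * Num.sqrt n%:R * q ^+ j.
Proof.
move=> a0 n0 aq; elim: j => [|j IH]; first by rewrite addn0 expr0 mulr1.
have n1 : 1 <= 1 + n%:R^-1 :> R by rewrite lerDl invr_ge0.
have q0 : 0 <= q by rewrite (le_trans _ aq)// mulr_ge0// (le_trans _ n1).
rewrite exprSr mulrA; apply: (le_trans _ (ler_wpM2r q0 IH)).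
rewrite addnS exprSr -!mulrA ler_wpM2l ?exprn_ge0//.
rewrite [leRHS]mulrC.
apply: (@le_trans _ _ (a * (1 + n%:R^-1) * Num.sqrt (n + j)%:R)); last first.
  by rewrite ler_wpM2r// sqrtr_ge0.
rewrite -mulrA ler_wpM2l//.
rewrite -[X in X * _](@ger0_norm _ (1 + n%:R^-1)) ?(le_trans _ n1)//.
rewrite -sqrtr_sqr -sqrtrM ?sqr_ge0// ler_wsqrtr// expr2 -mulrA.
apply: (@le_trans _ _ ((1 + n%:R^-1) * (n + j)%:R)); last first.
  by rewrite ler_peMl// mulr_ge0// (le_trans _ n1).
rewrite mulrDl mul1r -natr1 lerD2l ler_pdivlMl ?ltr0n// mulr1.
by rewrite ler_nat leq_addr.
Qed.

(** The geometric domination is summed from [n + m] on, uniformly in the cut-off [M]; the gain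
    [q ^+ m] makes the steps beyond a long block negligible. *)
Lemma walk_tail_le (q c : R) n m M e : 0 <= a -> (0 < n)%N ->
    a * (1 + n%:R^-1) <= q < 1 -> 0 <= c ->
    (forall w, (n <= size w)%N -> `|g w| <= c * Num.sqrt (size w)%:R) ->
  `|\sum_(n + m <= k < M) walk_step e k| <=
  c * (a ^+ n * Num.sqrt n%:R) * (q ^+ m / (1 - q)).
Proof.
move=> a0 n0 /andP[aq q1] c0 gub.
have q0 : 0 <= q by rewrite (le_trans _ aq)// mulr_ge0// addr_ge0// invr_ge0.
have B0 : 0 <= c * (a ^+ n * Num.sqrt n%:R).
  by rewrite mulr_ge0// mulr_ge0 ?sqrtr_ge0// exprn_ge0.
apply: (@le_trans _ _
    (\sum_(n + m <= k < M) c * (a ^+ n * Num.sqrt n%:R) * q ^+ (k - n))).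
  apply: (le_trans (ler_norm_sum _ _ _)); apply: ler_sum_nat => k /andP[nmk _].
  have nk : (n <= k)%N by rewrite (leq_trans _ nmk)// leq_addr.
  rewrite /walk_step !normrM normrX normr_sign mulr1 (ger0_norm a0).
  have := gub (mkseq e k); rewrite size_mkseq => /(_ nk) gk.
  apply: (le_trans (ler_wpM2l (exprn_ge0 k a0) gk)).
  rewrite mulrCA -mulrA ler_wpM2l//.
  have := exprM_sqrt_le (k - n) a0 n0 aq.
  by rewrite subnKC.
rewrite -mulr_sumr ler_wpM2l// -[(n + m)%N]add0n big_addn big_mkord.
under eq_bigr => i _ do rewrite addnCA addKn exprD mulrC.
rewrite -mulr_sumr ler_wpM2l ?exprn_ge0//.
rewrite -[leRHS]mul1r ler_pdivlMr ?subr_gt0// mulrC.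
rewrite -[1 - q]opprB mulNr -subrX1 opprB.
by rewrite lerBlDr lerDl exprn_ge0.
Qed.

End walks.

(** At [h = kappa ^+ n] the normalization carries the factor [a ^+ n * sqrt n] of the bounds on
    increments, which therefore cancels in the ratio. *)
Lemma kappa_norm (R : realType) (a : R) n : 0 < a < 1 ->
  Num.sqrt ((a ^+ 2) ^+ n * ln ((a ^+ 2) ^+ n)^-1) =
  a ^+ n * Num.sqrt n%:R * Num.sqrt (ln (a ^+ 2)^-1).
Proof.
move=> /andP[a0 a1]; rewrite -exprVn lnXn ?invr_gt0 ?exprn_gt0//.
rewrite -[ln _ *+ n]mulr_natl mulrA sqrtrM ?mulr_ge0 ?exprn_ge0 ?(ltW a0)//; congr (_ * _).
rewrite sqrtrM ?exprn_ge0 ?(ltW a0)//; congr (_ * _).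
by rewrite exprAC sqrtr_sqr ger0_norm// exprn_ge0// ltW.
Qed.

(** * Pathwise bounds at a fixed level *)

Section limit_path.
Variables (R : realType) (a : R) (g : seq bool -> R) (f : R -> R).
Hypothesis a01 : 0 < a < 1.
Hypothesis walk_cvg : forall t : R, t \in `[0, 1] ->
  walk a g (binexp t) M @[M --> \oo] --> f t.
Implicit Types (t s : R) (w : seq bool).

Let a0 : 0 < a. Proof. by case/andP: a01. Qed.

Let lnk_gt0 : 0 < ln (a ^+ 2)^-1.
Proof.
case/andP: a01 => _ a1.
by rewrite ln_gt0// invf_gt1 ?exprn_gt0// exprn_ilt1// ltW.
Qed.

Let cvg_increment t s : t \in `[0, 1] -> s \in `[0, 1] ->
  walk a g (binexp t) M - walk a g (binexp s) M @[M --> \oo] --> f t - f s.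
Proof. by move=> t01 s01; apply: cvgB; exact: walk_cvg. Qed.

Variables (q c : R) (n : nat).
Hypothesis n0 : (0 < n)%N.
Hypothesis aq1 : a * (1 + n%:R^-1) <= q < 1.
Hypothesis c0 : 0 <= c.
Hypothesis gub :
  forall w, (n <= size w)%N -> `|g w| <= c * Num.sqrt (size w)%:R.

(** The first [n] steps cancel and each of the two points leaves one tail, whence the factor 2. *)
Lemma increment_le t s : t \in `[0, 1] -> s \in `[0, 1] ->
  binprefix t n = binprefix s n ->
  `|f t - f s| <= a ^+ n * Num.sqrt n%:R * (2 * c / (1 - q)).
Proof.
move=> t01 s01 tsn; have cv := cvg_increment t01 s01.
have {}cv : `|walk a g (binexp t) M - walk a g (binexp s) M| @[M --> \oo] -->
    `|f t - f s| by exact: cvg_norm.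
rewrite -(cvg_lim _ cv)//.
apply: limr_le; first by apply/cvg_ex; exists `|f t - f s|.
near=> M; rewrite (walk_sub_agree a g _ tsn); last by near: M; exists n.
rewrite (le_trans (ler_normB _ _))//.
have tail e : `|\sum_(n <= k < M) walk_step a g e k| <=
    c * (a ^+ n * Num.sqrt n%:R) * (1 - q)^-1.
  have := walk_tail_le 0 M e (ltW a0) n0 aq1 c0 gub.
  by rewrite addn0 expr0 mul1r.
rewrite (le_trans (lerD (tail _) (tail _)))// le_eqVlt; apply/orP; left.
by apply/eqP; ring.
Unshelve. all: by end_near. Qed.

Lemma modulus_ratio_le :
  (modulus_ratio (a ^+ 2) f ((a ^+ 2) ^+ n) <=
   (2 * c / (1 - q) / Num.sqrt (ln (a ^+ 2)^-1))%:E)%E.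
Proof.
apply: ge_ereal_sup => _ [t [s [t01 s01 dts ->]]].
rewrite lee_fin kappa_norm// ler_pdivrMr; last first.
  by rewrite !mulr_gt0 ?sqrtr_gt0 ?ltr0n ?exprn_gt0.
rewrite [leRHS](_ : _ = a ^+ n * Num.sqrt n%:R * (2 * c / (1 - q))).
  apply: increment_le => //; apply: (dkappa_binprefix _ n0 dts).
  by case/andP: a01 => _ a1; rewrite exprn_gt0//= exprn_ilt1// ltW.
field; rewrite sqrtr_eq0 -ltNge lnk_gt0/=.
by case/andP: aq1 => _; rewrite -subr_gt0 => /gt_eqF ->.
Qed.

(** The two brothers share the prefix [w] and first differ at digit [size w], so their distance is
    exactly [kappa ^+ size w]. *)
Definition brother w b : R := word_point R (rcons w b).

Lemma binprefix_brother w b j :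
  binprefix (brother w b) (size w + j).+1 = w ++ b :: nseq j false.
Proof.
rewrite /binprefix /brother binexp_word_point.
apply: (@eq_from_nth _ false).
  by rewrite size_mkseq size_cat/= size_nseq addnS.
move=> i; rewrite size_mkseq => ij; rewrite nth_mkseq// nth_rcons nth_cat.
case: ltngtP => // [wi|->]; last by rewrite subnn.
by rewrite -[(i - _)%N]prednK ?subn_gt0//= nth_nseq if_same.
Qed.

(** In units of [a ^+ n * b * sqrt n], level [n] contributes 2 * 2 = 4, and level [n + j.+1]
    contributes [(a ^+ 2) ^+ j.+1] on each branch, a weight times an equal target. What lies beyond
    level [n + m] is charged to the two tails. *)
Lemma modulus_ratio_ge w (m : nat) (b : R) : size w = n ->
    2 * (b * Num.sqrt n%:R) <= g w ->
    (forall j, (j < m)%N -> 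
      a ^+ j.+1 * (b * Num.sqrt n%:R) <= g (w ++ false :: nseq j false)) ->
    (forall j, (j < m)%N -> 
      g (w ++ true :: nseq j false) <= - (a ^+ j.+1 * (b * Num.sqrt n%:R))) ->
  (((b * (4 + 2 * \sum_(j < m) (a ^+ 2) ^+ j.+1) -
      2 * c * q ^+ m.+1 / (1 - q)) /
     Num.sqrt (ln (a ^+ 2)^-1))%:E <=
   modulus_ratio (a ^+ 2) f ((a ^+ 2) ^+ n))%E.
Proof.
move=> wn g0 gF gT.
pose t := brother w false; pose s := brother w true.
have t01 : t \in `[0, 1] := word_point_itv R _.
have s01 : s \in `[0, 1] := word_point_itv R _.
have bn b' : binexp (brother w b') n = b'.
  by rewrite /brother binexp_word_point nth_rcons wn ltnn eqxx.
have pre b' : binprefix (brother w b') n = w.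
  have := binprefix_brother w b' 0; rewrite /binprefix mkseqS addn0 wn cats1.
  by move/rcons_inj => -[].
have tsn : binprefix t n = binprefix s n by rewrite !pre.
apply: le_ereal_sup_tmp.
exists (`|f t - f s| / Num.sqrt ((a ^+ 2) ^+ n * ln ((a ^+ 2) ^+ n)^-1))%:E.
  by exists t, s; split=> //; apply: dkappa_first_diff => //; rewrite !bn.
rewrite lee_fin kappa_norm// ler_pdivlMr; last first.
  by rewrite !mulr_gt0 ?sqrtr_gt0 ?ltr0n ?exprn_gt0.
rewrite [leLHS](_ : _ = a ^+ n * Num.sqrt n%:R *
  (b * (4 + 2 * \sum_(j < m) (a ^+ 2) ^+ j.+1) -
   2 * c * q ^+ m.+1 / (1 - q))); last first.
  field; rewrite sqrtr_eq0 -ltNge lnk_gt0/=.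
  by case/andP: aq1 => _; rewrite -subr_gt0 => /gt_eqF ->.
apply: le_trans (ler_norm _).
have cv := cvg_increment t01 s01; rewrite -(cvg_lim _ cv)//.
apply: limr_ge; first by apply/cvg_ex; exists (f t - f s).
near=> M; have nmM : (n + m.+1 <= M)%N by near: M; exists (n + m.+1)%N.
rewrite (walk_sub_agree a g _ tsn); last by rewrite (leq_trans _ nmM)// leq_addr.
have step0 b' :
    walk_step a g (binexp (brother w b')) n = a ^+ n * (-1) ^+ b' * g w.
  by rewrite /walk_step -/(binprefix _ _) pre bn.
have stepS b' j : walk_step a g (binexp (brother w b')) (n + j.+1) =
    a ^+ n * a ^+ j.+1 * g (w ++ b' :: nseq j false).
  have -> : walk_step a g (binexp (brother w b')) (n + j.+1) =
      a ^+ (n + j.+1) * (-1) ^+ (binexp (brother w b') (n + j.+1)) *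
      g (binprefix (brother w b') (n + j.+1)) by [].
  rewrite -exprD {3}addnS -{3}wn binprefix_brother /brother binexp_word_point.
  by rewrite nth_default ?mulr1// size_rcons wn addnS ltnS leq_addr.
have split_sum e : \sum_(n <= k < M) walk_step a g e k =
    walk_step a g e n + \sum_(j < m) walk_step a g e (n + j.+1) +
    \sum_(n + m.+1 <= k < M) walk_step a g e k.
  rewrite (big_cat_nat (n := n + m.+1))/= ?leq_addr//; congr (_ + _).
  rewrite -{1}[n in LHS]add0n big_addn addKn big_mkord big_ord_recl/= add0n.
  by congr (_ + _); apply: eq_bigr => j _; rewrite /bump/= addnC.
have tail e : `|\sum_(n + m.+1 <= k < M) walk_step a g e k| <= _ :=
  walk_tail_le m.+1 M e (ltW a0) n0 aq1 c0 gub.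
(* A lower bound for [f t - f s] takes the tail of [t] from below and that of [s] from above. *)
have := tail (binexp s); have := tail (binexp t).
rewrite !ler_norml => /andP[tl _] /andP[_ su].
rewrite !split_sum (step0 false) (step0 true) expr0 expr1 mulr1 mulrN1.
rewrite (eq_bigr _ (fun (j : 'I_m) _ => stepS false j)).
rewrite (eq_bigr _ (fun (j : 'I_m) _ => stepS true j)).
set y := b * Num.sqrt n%:R in g0 gF gT.
have main : a ^+ n * (y * (4 + 2 * \sum_(j < m) (a ^+ 2) ^+ j.+1)) <=
   a ^+ n * g w +
     \sum_(j < m) a ^+ n * a ^+ j.+1 * g (w ++ false :: nseq j false)
   - (- a ^+ n * g w +
     \sum_(j < m) a ^+ n * a ^+ j.+1 * g (w ++ true :: nseq j false)).
  have factor b' :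
      \sum_(j < m) a ^+ n * a ^+ j.+1 * g (w ++ b' :: nseq j false) =
      a ^+ n * \sum_(j < m) a ^+ j.+1 * g (w ++ b' :: nseq j false).
    by rewrite mulr_sumr; under eq_bigr do rewrite -mulrA.
  rewrite !factor mulNr -mulrN -!mulrDr -mulrBr ler_wpM2l ?exprn_ge0 ?(ltW a0)//.
  have -> : y * (4 + 2 * \sum_(j < m) (a ^+ 2) ^+ j.+1) =
      2 * y + \sum_(j < m) a ^+ j.+1 * (a ^+ j.+1 * y) - 
      (- (2 * y) + \sum_(j < m) a ^+ j.+1 * - (a ^+ j.+1 * y)).
    have sq (j : 'I_m) : a ^+ j.+1 * (a ^+ j.+1 * y) = (a ^+ 2) ^+ j.+1 * y.
      by rewrite mulrA -expr2 exprAC.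
    under [in RHS]eq_bigr do rewrite sq.
    under [X in _ = _ - (_ + X)]eq_bigr do rewrite mulrN sq.
    by rewrite sumrN -!mulr_suml; ring.
  rewrite lerB// lerD// ?lerN2//; apply: ler_sum => j _.
    by rewrite ler_wpM2l ?exprn_ge0 ?(ltW a0)// gF.
  by rewrite ler_wpM2l ?exprn_ge0 ?(ltW a0)// gT.
move: main; rewrite /y => main.
rewrite (_ : _ * (b * _ - _) =
   a ^+ n * (b * Num.sqrt n%:R * (4 + 2 * \sum_(j < m) (a ^+ 2) ^+ j.+1))
   - 2 * (c * (a ^+ n * Num.sqrt n%:R) * (q ^+ m.+1 / (1 - q)))); last by ring.
lra.
Unshelve. all: by end_near. Qed.

End limit_path.

(** * Upper limits along the powers of [kappa] *)

Section kappa_powers.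
Variables (R : realType) (kappa : R).
Hypothesis k01 : 0 < kappa < 1.

Lemma kappa_powers_to_0P (V : set R) : kappa_powers_to_0 kappa V <->
  exists n0, forall n, (n0 <= n)%N -> V (kappa ^+ n).
Proof.
have /andP[k0 k1] := k01.
have kn : kappa ^+ n @[n --> \oo] --> (0 : R).
  by apply: cvg_expr; rewrite gtr0_norm.
split.
  move=> [e /= e0 eV].
  have [n0 _ H] : \forall n \near \oo, kappa ^+ n < e.
    by move: kn => /cvgrPdist_lt/(_ _ e0); apply: filterS => n;
       rewrite sub0r normrN ger0_norm// exprn_ge0// ltW.
  exists n0 => n n0n; apply: (eV (kappa ^+ n)); rewrite ?exprn_gt0//=.
    by rewrite sub0r normrN gtr0_norm ?exprn_gt0//; exact: H.
  by exists n.
move=> [n0 Vn]; exists (kappa ^+ n0); rewrite /= ?exprn_gt0// => h /=.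
rewrite sub0r normrN => hn h0 [n _ nh]; rewrite -nh; apply: Vn.
by move: hn; rewrite -nh gtr0_norm ?exprn_gt0// ltr_iXn2l// => /ltnW.
Qed.

Lemma limf_esup_powers_le (F : R -> \bar R) (l : \bar R) n0 :
  (forall n, (n0 <= n)%N -> (F (kappa ^+ n)%R <= l)%E) ->
  (limf_esup F (kappa_powers_to_0 kappa) <= l)%E.
Proof.
move=> Fl; rewrite limf_esupE; apply: ge_ereal_inf.
pose V := [set h | exists2 n, (n0 <= n)%N & h = kappa ^+ n].
exists (ereal_sup (F @` V)).
  by exists V => //; apply/kappa_powers_to_0P; exists n0 => n n0n; exists n.
by apply: ge_ereal_sup => _ [_ [n n0n ->] <-]; exact: Fl.
Qed.

Lemma limf_esup_powers_ge (F : R -> \bar R) (l : \bar R) :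
  (forall n0, exists2 n, (n0 <= n)%N & (l <= F (kappa ^+ n)%R)%E) ->
  (l <= limf_esup F (kappa_powers_to_0 kappa))%E.
Proof.
move=> Fl; rewrite limf_esupE; apply: le_ereal_inf_tmp.
move=> _ [V /kappa_powers_to_0P[n0 Vn] <-].
have [n n0n lF] := Fl n0; apply: le_ereal_sup_tmp.
by exists (F (kappa ^+ n)) => //; exists (kappa ^+ n) => //; exact: Vn.
Qed.

End kappa_powers.

(** * Partial sums of the process as walks *)

Lemma Zn_walk d (T : measurableType d) (R : realType) (P : probability T R)
    (alpha : R) (N : seq bool -> {RV P >-> R}) n x (t : R) : t \in `[0, 1] ->
  Zn alpha N n x t =
  walk (2^-1 `^ (1 - alpha / 2)) (fun w => N w x) (binexp t) n.
Proof.
move=> t01; rewrite /walk big_mkord; apply: eq_bigr => k _.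
(* At [t], the two indicators of a word of length [k] both vanish unless this word is the prefix [u]
   of [t]. *)
pose u : k.-tuple bool := Tuple (introT eqP (size_mkseq (binexp t) k)).
rewrite (bigD1 u)//= big1 ?addr0 => [|w wu].
  rewrite !indic_Bword_rcons// size_mkseq eqxx /= powRrM powR_mulrn ?powR_ge0//.
  rewrite /walk_step; congr (_ * _ * _).
  by case: (binexp t k); rewrite /= ?expr1 ?expr0 ?subr0 ?sub0r.
rewrite !indic_Bword_rcons// size_tuple (_ : _ == _ = false); last first.
  by apply/negbTE; move: wu; rewrite -val_eqE eq_sym.
by rewrite /= subrr mulr0 mul0r.
Qed.

Lemma limit_process_walk d (T : measurableType d) (R : realType)
    (P : probability T R) (alpha : R) (N : seq bool -> {RV P >-> R})
    (Z : T -> R -> R) : is_limit_process alpha N Z ->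
  {ae P, forall x, forall t, t \in `[0, 1] ->
    walk (2^-1 `^ (1 - alpha / 2)) (fun w => N w x) (binexp t) M @[M --> \oo]
      --> Z x t}.
Proof.
apply: filterS => x Zu t t01.
under eq_fun do rewrite -Zn_walk//.
have sub : [set t] `<=` `[0, 1]%classic by move=> _ ->.
have := uniform_subset_cvg _ sub Zu; rewrite uniform_set1; apply.
Qed.

(** * Normal tails *)

Section normal_tails.
Variable R : realType.
Implicit Types x : R.
Local Notation mu := lebesgue_measure.

(* Comparing with the normal law of mean [x] bounds the tail beyond [x] without
   any change of variables. *)
Lemma normal_pdf_shift (x y : R) : 0 <= x * (y - x) ->
  normal_pdf 0 1 y <= expR (- x ^+ 2 / 2) * normal_pdf x 1 y.
Proof.
move=> xy; rewrite !normal_pdfE ?oner_eq0//= mulrCA ler_wpM2l ?normal_peak_ge0//.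
rewrite /normal_fun -expRD ler_expR subr0 expr1n; lra.
Qed.

Lemma measurable_EFin_normal_pdf (m : R) (A : set R) :
  measurable_fun A (fun y => (normal_pdf m 1 y)%:E).
Proof.
apply: measurable_funTS; apply/measurable_EFinP.
exact: measurable_normal_pdf. Qed.

Lemma normal_prob_shift (x : R) (A : set R) : measurable A ->
  (forall y, A y -> 0 <= x * (y - x)) ->
  (normal_prob 0 1 A <= (expR (- x ^+ 2 / 2))%:E)%E.
Proof.
move=> mA xA; apply: (@le_trans _ _
    (\int[mu]_(y in A) ((expR (- x ^+ 2 / 2))%:E * (normal_pdf x 1 y)%:E))%E).
  apply: ge0_le_integral => //.
  - by move=> y _; rewrite lee_fin normal_pdf_ge0.
  - exact: measurable_EFin_normal_pdf.
  - by apply: measurable_funeM; exact: measurable_EFin_normal_pdf.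
  - move=> y Ay; rewrite -EFinM lee_fin; exact/normal_pdf_shift/xA.
rewrite ge0_integralZl//; last 2 first.
  - exact: measurable_EFin_normal_pdf.
  - by move=> y _; rewrite lee_fin normal_pdf_ge0.
rewrite -[leRHS]mule1 lee_wpmul2l ?lee_fin ?expR_ge0//.
exact: (probability_le1 (normal_prob x 1) mA).
Qed.

Lemma normal_prob_abs_gt x : 0 <= x ->
  (normal_prob 0 1 [set y | (x < `|y|)%R] <= (2 * expR (- x ^+ 2 / 2))%:E)%E.
Proof.
move=> x0.
have -> : [set y : R | (x < `|y|)%R] = `]x, +oo[%classic `|` `]-oo, - x[%classic.
  apply/seteqP; split => y /=; rewrite !in_itv/= andbT ltrNr.
    by rewrite lter_normr => /orP[]; [left|right].
  by rewrite lter_normr => -[->//|->]; rewrite orbT.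
apply: (le_trans (measureU2 _ _ _)) => //.
rewrite mulrDl mul1r EFinD leeD//.
  apply: normal_prob_shift => // y /=; rewrite in_itv/= andbT => xy.
  by rewrite mulr_ge0// subr_ge0 ltW.
rewrite -[in leRHS](sqrrN x); apply: normal_prob_shift => // y /=.
rewrite in_itv/= => xy; rewrite mulNr -mulrN opprB mulr_ge0// subr_ge0.
by rewrite lerNr ltW// ltrNr.
Qed.

(** On an interval of length 1 the density is at least its value at [x + 1]. The loss against
    [expR (- x ^+ 2 / 2)] is a factor [expR (- O(x))], harmless at the scale of large deviations. *)
Lemma normal_prob_itv_ge x (l u : R) : 0 <= x -> u - l = 1 ->
  (forall y, l <= y <= u -> y ^+ 2 <= (x + 1) ^+ 2) ->
  ((normal_peak 1 * expR (- (x + 1) ^+ 2 / 2))%:E <=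
   normal_prob 0 1 `[l, u]%classic)%E.
Proof.
move=> x0 lu yx; apply: (@le_trans _ _
    (\int[mu]_(y in `[l, u]) (normal_peak 1 * expR (- (x + 1) ^+ 2 / 2))%:E)%E).
  rewrite integral_cst//= lebesgue_measure_itv/= lte_fin -subr_gt0 lu ltr01.
  by rewrite -EFinB lu mule1.
apply: ge0_le_integral => //.
- by move=> y _; rewrite lee_fin mulr_ge0 ?expR_ge0 ?normal_peak_ge0.
- exact: measurable_EFin_normal_pdf.
- move=> y; rewrite /= in_itv/= => /yx yx'; rewrite lee_fin normal_pdfE ?oner_eq0//=.
  rewrite ler_wpM2l ?normal_peak_ge0// /normal_fun ler_expR subr0 expr1n; lra.
Qed.

Lemma normal_prob_ge x : 0 <= x ->
  ((normal_peak 1 * expR (- (x + 1) ^+ 2 / 2))%:E <=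
   normal_prob 0 1 `[x, +oo[%classic)%E.
Proof.
move=> x0; apply: (@le_trans _ _ (normal_prob 0 1 `[x, x + 1]%classic)).
  apply: normal_prob_itv_ge => // [|y /andP[xy yx]]; first by ring.
  by rewrite ler_sqr// nnegrE ?addr_ge0// (le_trans x0).
apply: le_measure; rewrite ?inE//.
by move=> y /=; rewrite !in_itv/= andbT => /andP[].
Qed.

Lemma normal_prob_le x : 0 <= x ->
  ((normal_peak 1 * expR (- (x + 1) ^+ 2 / 2))%:E <=
   normal_prob 0 1 `]-oo, (- x)%R]%classic)%E.
Proof.
move=> x0.
apply: (@le_trans _ _ (normal_prob 0 1 `[(- (x + 1))%R, (- x)%R]%classic)).
  apply: normal_prob_itv_ge => // [|y /andP[xy yx]]; first by ring.
  by rewrite -sqrrN ler_sqr ?nnegrE ?addr_ge0//; lra.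
apply: le_measure; rewrite ?inE//.
by move=> y /=; rewrite !in_itv/= => /andP[].
Qed.

End normal_tails.

(** * Independent blocks *)

Section independent_blocks.
Context d (T : measurableType d) (R : realType) (P : probability T R).
Variables (I : choiceType) (X : I -> {RV P >-> R}) (A : I -> set R).
Hypothesis indX : mutually_independent X.
Hypothesis mA : forall i, measurable (A i).

Definition joint_event (s : seq I) : set T :=
  \bigcap_(i in [set` s]) (X i @^-1` A i).

Local Notation p i := (fine (P (X i @^-1` A i))).

Lemma measurable_joint_event s : measurable (joint_event s).
Proof.
apply: fin_bigcap_measurable => // i _.
by rewrite -[_ @^-1` _]setTI; exact: measurable_funPT.
Qed.

Lemma joint_event_cat s t :
  joint_event (s ++ t) = joint_event s `&` joint_event t.
Proof.
rewrite /joint_event -bigcap_setU; congr bigcap; apply/seteqP; split => i /=.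
  by rewrite mem_cat => /orP.
by move=> /orP; rewrite -mem_cat.
Qed.

Lemma prob_joint_event s :
  uniq s -> P (joint_event s) = (\prod_(i <- s) p i)%:E.
Proof.
move=> us; rewrite /joint_event indX// -prodEFin; apply: eq_bigr => i _.
rewrite fineK// fin_num_measure// -[_ @^-1` _]setTI; exact: measurable_funPT.
Qed.

Lemma measurable_no_block bs :
  measurable (\big[setI/setT]_(b <- bs) ~` joint_event b).
Proof.
elim/big_ind: _ => //; first by move=> *; exact: measurableI.
by move=> b _; exact/measurableC/measurable_joint_event.
Qed.

(* Induction on [bs]: removing the event of a block [b] amounts to subtracting
   the probability in which [b] is added to the prescribed indices [s]. *)
Lemma prob_joint_no_block s bs : uniq (s ++ flatten bs) ->
  P (joint_event s `&` \big[setI/setT]_(b <- bs) ~` joint_event b) =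
  (\prod_(i <- s) p i * \prod_(b <- bs) (1 - \prod_(i <- b) p i))%:E.
Proof.
elim: bs s => [|b bs IH] s /=.
  by rewrite cats0 !big_nil setIT mulr1; exact: prob_joint_event.
move=> usb; rewrite !big_cons.
set G := \big[setI/setT]_(b <- bs) _.
have mG : measurable G by exact: measurable_no_block.
have -> : joint_event s `&` (~` joint_event b `&` G) =
    (joint_event s `&` G) `\` joint_event b by rewrite setIA setIAC.
have mJ := measurable_joint_event.
rewrite measureD//; last 2 first.
- exact: measurableI.
- by rewrite ltey_eq fin_num_measure//; exact: measurableI.
have us : uniq (s ++ flatten bs).
  move: usb; rewrite !cat_uniq has_cat negb_or.
  by move=> /and3P[-> /andP[_ ->] /and3P[_ _ ->]].
have usb' : uniq ((s ++ b) ++ flatten bs) by rewrite -catA.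
rewrite setIAC -joint_event_cat.
have Es := IH s us; have Esb := IH _ usb'; rewrite -/G in Es Esb.
transitivity (P (joint_event s `&` G) - P (joint_event (s ++ b) `&` G))%E => //.
rewrite Es Esb.
by rewrite -EFinB big_cat/=; congr EFin; ring.
Qed.

Lemma prob_no_block bs : uniq (flatten bs) ->
  P (\big[setI/setT]_(b <- bs) ~` joint_event b) =
  (\prod_(b <- bs) (1 - \prod_(i <- b) p i))%:E.
Proof.
move=> ubs; have := @prob_joint_no_block [::] bs ubs.
by rewrite /joint_event set_nil bigcap_set0 setTI big_nil mul1r.
Qed.

End independent_blocks.

(** * Almost sure growth of the normal variables *)

Lemma measure_bigsetU_seq_le d (T : measurableType d) (R : realType)
    (mu : {measure set T -> \bar R}) (I : Type) (s : seq I) (E : I -> set T) :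
  (forall i, measurable (E i)) ->
  (mu (\big[setU/set0]_(i <- s) E i) <= \sum_(i <- s) mu (E i))%E.
Proof.
move=> mE; elim: s => [|i s IH]; first by rewrite !big_nil measure0.
rewrite !big_cons; apply: le_trans (measureU2 _ _ _) _ => //.
  by elim/big_ind : _ => // *; exact: measurableU.
by rewrite leeD2l.
Qed.

Section eventual_bound.
Context d (T : measurableType d) (R : realType) (P : probability T R).
Variables (X : seq bool -> {RV P >-> R}).
Hypothesis normalX : forall w, standard_normal (X w).

(** Borel-Cantelli over the lengths [k]: each of the [2 ^ k] words exceeds the bound with
    probability at most [2 * expR (- c ^+ 2 * k / 2)], so the union bound gives the summable
    [2 * r ^+ k]. *)
Lemma ae_eventually_le_sqrt_size (c : R) :
  0 <= c -> 2 * expR (- c ^+ 2 / 2) < 1 ->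
  {ae P, forall x, exists K, forall w, (K <= size w)%N ->
    `|X w x| <= c * Num.sqrt (size w)%:R}.
Proof.
move=> c0 r1; set r := 2 * _ in r1.
have r0 : 0 <= r by rewrite mulr_ge0 ?expR_ge0.
pose A k := [set y : R | c * Num.sqrt k%:R < `|y|].
have mA k : measurable (A k).
  rewrite (_ : A k =
    (fun y : R => `|y|) @^-1` `]c * Num.sqrt k%:R, +oo[%classic); last first.
    by apply/seteqP; split => y /=; rewrite in_itv/= andbT.
  by rewrite -[_ @^-1` _]setTI; exact: normr_measurable.
pose E w := X w @^-1` A (size w).
have mE w : measurable (E w).
  by rewrite /E -[_ @^-1` _]setTI; exact: measurable_funPT.
pose F k := \big[setU/set0]_(w <- enum {: k.-tuple bool}) E w.
have mF k : measurable (F k).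
  by rewrite /F; elim/big_ind : _ => // *; exact: measurableU.
have PF k : (P (F k) <= (2 * r ^+ k)%:E)%E.
  apply: (le_trans (measure_bigsetU_seq_le P _ (fun w : k.-tuple bool => mE w))).
  apply: (@le_trans _ _ (\sum_(w <- enum {: k.-tuple bool})
      (2 * expR (- (c ^+ 2 * k%:R) / 2))%:E)%E).
    apply: lee_sum => w _; rewrite /E size_tuple.
    rewrite [leLHS](_ : _ = normal_prob 0 1 (A k)); last exact: normalX.
    apply: (le_trans (normal_prob_abs_gt _)).
      by rewrite mulr_ge0// sqrtr_ge0.
    by rewrite exprMn sqr_sqrtr.
  rewrite sumEFin lee_fin big_enum/= sumr_const card_tuple card_bool.
  have -> : expR (- (c ^+ 2 * k%:R) / 2) = expR (- c ^+ 2 / 2) ^+ k.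
    by rewrite -expRM_natl; congr expR; ring.
  rewrite /r exprMn -[leLHS]mulr_natr natrX le_eqVlt; apply/orP; left; apply/eqP.
  by ring.
have : P.-negligible (lim_sup_set F).
  apply/negligibleP.
    by apply: bigcapT_measurable => n; apply: bigcup_measurable => k _.
  apply: lim_sup_set_cvg0 => //.
  apply: (@le_lt_trans _ _ (2 / (1 - r))%:E); last exact: ltry.
  apply: lime_le; first exact: is_cvg_nneseries.
  apply: nearW => n; apply: (@le_trans _ _ (\sum_(0 <= k < n) (2 * r ^+ k)%:E)%E).
    by apply: lee_sum => k _; exact: PF.
  rewrite sumEFin lee_fin -mulr_sumr ler_wpM2l// big_mkord.
  rewrite -[leRHS]mul1r ler_pdivlMr ?subr_gt0// mulrC.
  rewrite -[1 - r]opprB mulNr -subrX1 opprB.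
  by rewrite lerBlDr lerDl exprn_ge0.
apply: negligibleS => x /= xN n _; apply: contrapT => H; apply: xN.
exists n => w nw; rewrite leNgt; apply/negP => wX; apply: H.
exists (size w) => //; rewrite /F -bigcup_seq.
by exists (in_tuple w) => //=; rewrite mem_enum.
Qed.

End eventual_bound.

(** * Favourable blocks of words *)

Section lower_events.
Variables (R : realType) (a : R).
Hypothesis a0 : 0 <= a.
Implicit Types (u v w : seq bool) (m n : nat) (y : R).

(* The words [v] of length at most [m] such that [w ++ v] is a prefix of the
   point [w000...] or [w1000...], for any word [w]. *)
Definition suffixes m : seq (seq bool) :=
  [::] :: [seq false :: nseq j false | j <- iota 0 m] ++
          [seq true :: nseq j false | j <- iota 0 m].

(* Up to the scaling [a ^+ n], the coefficient of the variable indexed by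
   [w ++ v], [size w = n], in the increment between these points, in absolute
   value: it is negative exactly when [v] starts with [true]. *)
Definition weight v : R := if v is [::] then 2 else a ^+ size v.

(* The product of the probabilities of these targets has the order
   [exp (- y ^+ 2 / 2 * \sum_v weight v ^+ 2)] of the optimal large deviation. *)
Definition target y v : set R :=
  if v is true :: _ then `]-oo, - (weight v * y)] else `[weight v * y, +oo[.

Definition block m w : seq (seq bool) := [seq w ++ v | v <- suffixes m].

Lemma weight_ge0 v : 0 <= weight v.
Proof. by case: v => [|b v]//=; exact: exprn_ge0. Qed.

Lemma measurable_target y v : measurable (target y v).
Proof. by case: v => [|[] v]/=. Qed.

Lemma uniq_suffixes m : uniq (suffixes m).
Proof.
have inj b : injective (fun j => b :: nseq j false).
  by move=> i j [/(congr1 size)]; rewrite !size_nseq.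
rewrite /= mem_cat negb_or cat_uniq !map_inj_uniq ?iota_uniq//=.
rewrite andbT -andbA; apply/and3P; split; last apply/hasPn.
- by apply/mapP => -[].
- by apply/mapP => -[].
- by move=> _ /mapP[j _ ->]; apply/mapP => -[].
Qed.

(** As the words of [ws] have a common length, [w] and [v] can be read off from [w ++ v]. The blocks
    are thus disjoint, and independence of the variables passes to them. *)
Lemma uniq_blocks m n (ws : seq (seq bool)) : uniq ws ->
  (forall w, w \in ws -> size w = n) -> uniq (flatten (map (block m) ws)).
Proof.
move=> uws wsn; apply: (allpairs_uniq uws (uniq_suffixes m)).
move=> [w v] [w' v'].
move=> /flatten_mapP[w1 w1s /mapP[v1 _ [-> ->]]].
move=> /flatten_mapP[w2 w2s /mapP[v2 _ [-> ->]]] /= /eqP.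
by rewrite eqseq_cat ?wsn// => /andP[/eqP -> /eqP ->].
Qed.

Lemma sum_weight_sqr m :
  \sum_(v <- suffixes m) weight v ^+ 2 = 4 + 2 * \sum_(j < m) (a ^+ 2) ^+ j.+1.
Proof.
have E b : \sum_(j <- iota 0 m) weight (b :: nseq j false) ^+ 2 =
    \sum_(j < m) (a ^+ 2) ^+ j.+1.
  rewrite -(big_mkord xpredT (fun j => (a ^+ 2) ^+ j.+1)) /index_iota subn0.
  by apply: eq_bigr => j _; rewrite /weight/= size_nseq exprAC.
by rewrite big_cons big_cat/= !big_map !E /weight; ring.
Qed.

Context d (T : measurableType d) (P : probability T R).
Variable X : seq bool -> {RV P >-> R}.
Hypothesis normalX : forall w, standard_normal (X w).
Hypothesis indX : mutually_independent X.

Lemma fine_prob_itv (A : set T) : measurable A -> 0 <= fine (P A) <= 1.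
Proof.
move=> mA; rewrite fine_ge0//= -lee_fin fineK ?fin_num_measure//.
exact: probability_le1.
Qed.

Lemma prob_target_ge y v w : 0 <= y ->
  normal_peak 1 * expR (- (weight v * y + 1) ^+ 2 / 2) <=
  fine (P (X w @^-1` target y v)).
Proof.
move=> y0; rewrite -lee_fin fineK; last first.
  apply: fin_num_measure; rewrite -[_ @^-1` _]setTI; apply: measurable_funPT => //.
  exact: measurable_target.
rewrite [leRHS](_ : _ = normal_prob 0 1 (target y v)); last first.
  by apply: normalX; exact: measurable_target.
have wy : 0 <= weight v * y by rewrite mulr_ge0// weight_ge0.
by rewrite /target; case: v wy => [|[] v] wy;
  [exact: normal_prob_ge|exact: normal_prob_le|exact: normal_prob_ge].
Qed.

(** [Q], [L] and [C] collect the coefficients of [(weight v * y + 1) ^+ 2 / 2 - ln (normal_peak 1)]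
    in powers of [y], summed over the suffixes. *)
Let Q m : R := (\sum_(v <- suffixes m) weight v ^+ 2) / 2.
Let L m : R := \sum_(v <- suffixes m) weight v.
Let C m : R := \sum_(v <- suffixes m) (2^-1 - ln (normal_peak 1)).

(** A word [u = w ++ v] of a block has [drop n u = v], so targets that depend on [v] alone can be
    indexed by whole words. *)
Lemma prod_target_ge m n y w : 0 <= y -> size w = n ->
  expR (- (Q m * y ^+ 2 + L m * y + C m)) <=
  \prod_(u <- block m w) fine (P (X u @^-1` target y (drop n u))).
Proof.
move=> y0 wn; rewrite big_map.
apply: (@le_trans _ _ (\prod_(v <- suffixes m)
   (normal_peak 1 * expR (- (weight v * y + 1) ^+ 2 / 2)))); last first.
  apply: ler_prod => v _; rewrite -wn drop_size_cat// prob_target_ge// andbT.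
  by rewrite mulr_ge0 ?expR_ge0 ?normal_peak_ge0.
have pk : normal_peak (1 : R) \is Num.pos by rewrite posrE normal_peak_gt0// oner_eq0.
under eq_bigr do rewrite -[normal_peak 1]lnK// -expRD.
rewrite -expR_sum ler_expR /Q /L /C mulrAC !mulr_suml -!big_split/= -sumrN.
by apply: ler_sum => v _; lra.
Qed.

Definition no_block_event m n y : set T :=
  \big[setI/setT]_(B <- map (block m \o @tval n bool) (enum {: n.-tuple bool}))
    ~` joint_event X (fun u => target y (drop n u)) B.

(** The [2 ^ n] blocks are independent, and [1 - p <= expR (- p)] turns the product of the failure
    probabilities into one exponential. *)
Lemma prob_no_block_event_le m n y : 0 <= y ->
  (P (no_block_event m n y) <=
   (expR (- (2 ^+ n * expR (- (Q m * y ^+ 2 + L m * y + C m)))))%:E)%E.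
Proof.
move=> y0; rewrite /no_block_event prob_no_block//; last 2 first.
- by move=> u; exact: measurable_target.
- rewrite map_comp; apply: (@uniq_blocks _ n).
    by rewrite map_inj_uniq ?enum_uniq//; exact: val_inj.
  by move=> _ /mapP[w _ ->]; rewrite size_tuple.
rewrite lee_fin big_map big_enum/=.
set e := expR (- (_ + _)).
apply: (@le_trans _ _ (\prod_(w : n.-tuple bool) expR (- e))).
  apply: ler_prod => w _; apply/andP; split.
    rewrite subr_ge0; apply: Num.Theory.prodr_ile1 => u _.
    apply/fine_prob_itv; rewrite -[_ @^-1` _]setTI; apply: measurable_funPT => //.
    exact: measurable_target.
  apply: (le_trans _ (expR_ge1Dx _)); rewrite lerD2l lerN2.
  by apply: prod_target_ge => //; exact: size_tuple.
by rewrite prodr_const card_tuple card_bool -expRM_natl natrX mulrN.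
Qed.

Lemma measurable_no_block_event m n y : measurable (no_block_event m n y).
Proof. by apply: measurable_no_block => u; exact: measurable_target. Qed.

(** With [y = b * sqrt n] the expected number of successful words is at least
    [expR (th * n - O(sqrt n))] with [th > 0], hence unbounded. *)
Lemma exists_prob_no_block_event_lt m (b e : R) n0 : 0 <= b -> 0 < e ->
    (4 + 2 * \sum_(j < m) (a ^+ 2) ^+ j.+1) * b ^+ 2 / 2 < ln 2 ->
  exists2 n, (n0 <= n)%N &
    (P (no_block_event m n (b * Num.sqrt n%:R)) < e%:E)%E.
Proof.
move=> b0 e0 Qb.
pose th := ln 2 - Q m * b ^+ 2.
have th0 : 0 < th by rewrite subr_gt0 /Q sum_weight_sqr mulrAC.
have L0 : 0 <= L m by apply: sumr_ge0 => v _; exact: weight_ge0.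
(* For [l >= M] this gives [th * l - L m * b >= |C m| + 1/e]. *)
pose M := (L m * b + `|C m| + e^-1) / th.
have M0 : 0 <= M.
  by rewrite divr_ge0 ?(ltW th0)// !addr_ge0// ?mulr_ge0// invr_ge0 ltW.
have [l [n0l l1 Ml]] : exists l, [/\ (n0 <= l)%N, 1 <= l%:R :> R & M <= l%:R].
  exists (maxn n0.+1 (Num.bound M)); split.
  - by rewrite leq_max leqnSn.
  - by rewrite ler1n leq_max.
  - by rewrite (le_trans (ltW (archi_boundP M0)))// ler_nat leq_maxr.
(* The square makes [Num.sqrt n%:R] an integer. *)
exists (l ^ 2)%N.
  by rewrite (leq_trans n0l)// -mulnn leq_pmulr// -(ltr0n R) (lt_le_trans _ l1).
apply: (le_lt_trans (prob_no_block_event_le _ _ _)).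
  by rewrite mulr_ge0// sqrtr_ge0.
rewrite natrX sqrtr_sqr ger0_norm// lte_fin.
have two : (2 : R) ^+ (l ^ 2)%N = expR (l%:R ^+ 2 * ln 2).
  by rewrite -[l%:R ^+ 2]natrX expRM_natl lnK// posrE.
rewrite two -expRD.
set E := _ + - (_ + _ + _).
have EM : e^-1 <= E.
  have -> : E = l%:R * (th * l%:R - L m * b) - C m by rewrite /E /th; ring.
  have : L m * b + `|C m| + e^-1 <= th * l%:R by rewrite [leRHS]mulrC -ler_pdivrMr.
  have e1 : 0 <= e^-1 by rewrite invr_ge0 ltW.
  have := ler_norm (C m); have := normr_ge0 (C m).
  set D := th * l%:R - L m * b => C0 C1 H.
  have HD : `|C m| + e^-1 <= D by rewrite /D; lra.
  have : D <= l%:R * D by rewrite ler_peMl//; lra.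
  lra.
(* The chain is [1/e <= E < 1 + E <= expR E <= expR (expR E)]. *)
rewrite expRN invf_plt ?posrE ?expR_gt0//.
apply: (le_lt_trans EM).
apply: (@lt_le_trans _ _ (1 + E)); first by rewrite ltrDr.
apply: (le_trans (expR_ge1Dx E)); apply: (le_trans _ (expR_ge1Dx _)).
by rewrite lerDr.
Qed.

(** Failure at all levels from [n0] on is contained in failure at each of them, whose probability
    comes arbitrarily close to 0; hence it is negligible for every [n0]. *)
Lemma ae_frequently_block m (b : R) : 0 <= b ->
    (4 + 2 * \sum_(j < m) (a ^+ 2) ^+ j.+1) * b ^+ 2 / 2 < ln 2 ->
  {ae P, forall x, forall n0, exists2 n, (n0 <= n)%N & exists2 w, size w = n &
    [/\ 2 * (b * Num.sqrt n%:R) <= X w x,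
        forall j, (j < m)%N ->
          a ^+ j.+1 * (b * Num.sqrt n%:R) <= X (w ++ false :: nseq j false) x &
        forall j, (j < m)%N ->
          X (w ++ true :: nseq j false) x <= - (a ^+ j.+1 * (b * Num.sqrt n%:R))]}.
Proof.
move=> b0 Qb; apply: ae_foralln => n0.
pose NB n := no_block_event m n (b * Num.sqrt n%:R).
pose B := \bigcap_(n in [set n | (n0 <= n)%N]) NB n.
have mNB n : measurable (NB n) by exact: measurable_no_block_event.
have mB : measurable B by apply: bigcap_measurable => // ; exists n0 => /=.
suff : P.-negligible B.
  apply: negligibleS => x /= H n n0n; rewrite /NB /no_block_event.
  rewrite -bigcap_seq => _ /= /mapP[w _ ->] xw; apply: H.
  exists n => //; exists w; first exact: size_tuple.
  have xt v : v \in suffixes m -> target (b * Num.sqrt n%:R) v (X (w ++ v) x).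
    move=> vm; have /= := xw (w ++ v) (map_f _ vm).
    by rewrite drop_size_cat// size_tuple.
  split.
  - by have := xt [::] (mem_head _ _); rewrite /= in_itv/= andbT cats0.
  - move=> j jm; have /xt : false :: nseq j false \in suffixes m.
      rewrite inE/= mem_cat; apply/orP; left; apply/mapP; exists j => //.
      by rewrite mem_iota.
    by rewrite /= in_itv/= andbT size_nseq.
  - move=> j jm; have /xt : true :: nseq j false \in suffixes m.
      rewrite inE/= mem_cat; apply/orP; right; apply/mapP; exists j => //.
      by rewrite mem_iota.
    by rewrite /= in_itv/= size_nseq.
apply/negligibleP => //; apply/eqP; apply: contrapT => /negP PB.
have PB0 : 0 < fine (P B).
  by rewrite fine_gt0// lt0e PB measure_ge0/= ltey_eq fin_num_measure.
have [n n0n] := @exists_prob_no_block_event_lt m b _ n0 b0 PB0 Qb.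
rewrite fineK ?fin_num_measure//; apply/negP; rewrite -leNgt.
apply: le_measure; rewrite ?inE//.
  exact: mNB.
by move=> x; exact.
Qed.

End lower_events.

(** * The modulus of continuity *)

Lemma cvg_le_ereal (R : realType) (x : \bar R) (u : R^nat) (l : R) :
  u @ \oo --> l -> (\forall n \near \oo, (x <= (u n)%:E)%E) -> (x <= l%:E)%E.
Proof.
move=> ul xu; have ul' : (u n)%:E @[n --> \oo] --> l%:E.
  by apply: cvg_EFin; [exact: nearW|].
rewrite -(cvg_lim _ ul')//; apply: lime_ge => //.
by apply/cvg_ex; exists l%:E.
Qed.

Lemma cvg_ge_ereal (R : realType) (x : \bar R) (u : R^nat) (l : R) :
  u @ \oo --> l -> (\forall n \near \oo, ((u n)%:E <= x)%E) -> (l%:E <= x)%E.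
Proof.
move=> ul xu; have ul' : (u n)%:E @[n --> \oo] --> l%:E.
  by apply: cvg_EFin; [exact: nearW|].
rewrite -(cvg_lim _ ul')//; apply: lime_le => //.
by apply/cvg_ex; exists l%:E.
Qed.

Section modulus_bounds.
Variables (R : realType) (a : R).
Hypothesis a01 : 0 < a < 1.

Let a0 : 0 < a. Proof. by case/andP: a01. Qed.
Let a1 : a < 1. Proof. by case/andP: a01. Qed.
Let k01 : 0 < a ^+ 2 < 1.
Proof. by rewrite exprn_gt0//= exprn_ilt1// ltW. Qed.
Let S0 : 0 < Num.sqrt (ln (a ^+ 2)^-1).
Proof. by case/andP: k01 => k0 k1; rewrite sqrtr_gt0 ln_gt0// invf_gt1. Qed.

(** Each [p] gives a bound with constants [c p] and [q p], slightly above [sqrt (2 * ln 2)] and [a].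
    An integer parameter leaves only countably many almost sure events to intersect. *)
Lemma limf_esup_modulus_le (g : seq bool -> R) (f : R -> R) :
  (forall t : R, t \in `[0, 1] ->
    walk a g (binexp t) M @[M --> \oo] --> f t) ->
  (forall p, exists K, forall w, (K <= size w)%N ->
    `|g w| <= Num.sqrt (2 * ln 2 * (1 + p.+1%:R^-1)) * Num.sqrt (size w)%:R) ->
  (limf_esup (modulus_ratio (a ^+ 2) f) (kappa_powers_to_0 (a ^+ 2)) <=
   (2 * Num.sqrt (2 * ln 2) /
     (Num.sqrt (ln (a ^+ 2)^-1) * (1 - a)))%:E)%E.
Proof.
move=> walkf gub.
pose q p : R := a * (1 + p.+1%:R^-1).
pose c p : R := Num.sqrt (2 * ln 2 * (1 + p.+1%:R^-1)).
have h1 : (fun p : nat => 1 + p.+1%:R^-1 : R) @ \oo --> (1 : R).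
  by have := cvgD (cvg_cst (1 : R)) (@cvg_harmonic R); rewrite addr0; apply.
have qa : q @ \oo --> a.
  by have := cvgM (cvg_cst a) h1; rewrite mulr1; apply.
have cc : c @ \oo --> Num.sqrt (2 * ln 2).
  have h2 : (fun p : nat => 2 * ln 2 * (1 + p.+1%:R^-1) : R) @ \oo -->
      (2 * ln 2 : R).
    by have := cvgM (cvg_cst (2 * ln 2 : R)) h1; rewrite mulr1; apply.
  exact: (continuous_cvg _ (@sqrt_continuous R _) h2).
apply: (@cvg_le_ereal _ _
   (fun p => 2 * c p / (1 - q p) / Num.sqrt (ln (a ^+ 2)^-1))).
  have -> : 2 * Num.sqrt (2 * ln 2) / (Num.sqrt (ln (a ^+ 2)^-1) * (1 - a)) =
      2 * Num.sqrt (2 * ln 2) / (1 - a) / Num.sqrt (ln (a ^+ 2)^-1).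
    by rewrite invfM [_^-1 * _]mulrC mulrA.
  apply: cvgM; last exact: cvg_cst.
  apply: cvgM; first by apply: cvgM => //; exact: cvg_cst.
  apply: cvgV; first by rewrite subr_eq0 gt_eqF.
  by apply: cvgB => //; exact: cvg_cst.
have : \forall p \near \oo, q p < 1 by apply: (cvgr_lt a).
apply: filterS => p q1.
have [K gK] := gub p.
(* Levels [n >= p.+1] satisfy [a * (1 + 1/n) <= q p]. *)
apply: (limf_esup_powers_le k01 (n0 := maxn K p.+1)) => n.
rewrite geq_max => /andP[Kn pn].
apply: (modulus_ratio_le a01 walkf) => //.
- exact: leq_ltn_trans pn.
- rewrite q1 andbT ler_wpM2l ?(ltW a0)// lerD2l lef_pV2 ?posrE ?ltr0n ?ler_nat//.
  exact: leq_ltn_trans pn.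
- by rewrite sqrtr_ge0.
- by move=> w nw; apply: gK; exact: leq_trans nw.
Qed.

Let gm m : R := 4 + 2 * \sum_(j < m) (a ^+ 2) ^+ j.+1.

(** For fixed [m], infinitely many levels carry a good block, which gives a bound with an error of
    order [q ^+ m]; then [m] goes to infinity. The constant [c] enters only this error. *)
Lemma limf_esup_modulus_ge (g : seq bool -> R) (f : R -> R) (c b gamma : R) :
  (forall t : R, t \in `[0, 1] ->
    walk a g (binexp t) M @[M --> \oo] --> f t) -> 0 <= c ->
  (exists K, forall w, (K <= size w)%N ->
    `|g w| <= c * Num.sqrt (size w)%:R) ->
  (forall m n0, exists2 n, (n0 <= n)%N & exists2 w, size w = n &
     [/\ 2 * (b * Num.sqrt n%:R) <= g w,
        forall j, (j < m)%N ->
          a ^+ j.+1 * (b * Num.sqrt n%:R) <= g (w ++ false :: nseq j false) &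
        forall j, (j < m)%N ->
          g (w ++ true :: nseq j false) <= - (a ^+ j.+1 * (b * Num.sqrt n%:R))]) ->
  gm @ \oo --> gamma ->
  ((b * gamma / Num.sqrt (ln (a ^+ 2)^-1))%:E <=
   limf_esup (modulus_ratio (a ^+ 2) f) (kappa_powers_to_0 (a ^+ 2)))%E.
Proof.
move=> walkf c0 [K gK] blocks gmg.
(* A ratio strictly between [a] and 1 that does not depend on [m]. *)
pose q := (1 + a) / 2.
have q1 : q < 1 by rewrite /q; move: a1; lra.
have q0 : 0 < q by rewrite /q; move: a0; lra.
have aq : a < q by rewrite /q; move: a1; lra.
apply: (@cvg_ge_ereal _ _ (fun m => (b * gm m - 2 * c * q ^+ m.+1 / (1 - q)) /
     Num.sqrt (ln (a ^+ 2)^-1))).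
  apply: cvgM; last exact: cvg_cst.
  rewrite -[b * gamma]subr0; apply: cvgB.
    by apply: cvgM => //; exact: cvg_cst.
  rewrite -(mul0r (1 - q)^-1); apply: cvgM; last exact: cvg_cst.
  rewrite -(mulr0 (2 * c)); apply: cvgM; first exact: cvg_cst.
  rewrite (cvg_shiftS (fun m => q ^+ m)).
  by apply: cvg_expr; rewrite gtr0_norm.
apply: nearW => m; apply: (limf_esup_powers_ge k01) => n0.
(* From [n >= a / (q - a)] follows [a * (1 + 1/n) <= q]. *)
pose K' := Num.bound (a / (q - a)).
have [n nn [w wn [g0 gF gT]]] := blocks m (maxn n0 (maxn K K'.+1)).
move: nn; rewrite !geq_max => /and3P[n0n Kn K'n].
have n_gt0 : (0 < n)%N by exact: leq_ltn_trans K'n.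
exists n => //.
apply: (modulus_ratio_ge a01 walkf (q := q) (c := c) n_gt0 _ c0 _ wn) => //.
  rewrite q1 andbT mulrDr mulr1 -lerBrDl ler_pdivrMr ?ltr0n//.
  rewrite -ler_pdivrMl ?subr_gt0//.
  rewrite mulrC (le_trans (ltW (archi_boundP _)))// ?ler_nat; last exact: ltnW.
  by rewrite divr_ge0 ?(ltW a0)// subr_ge0 ltW.
by move=> v nv; apply: gK; exact: leq_trans nv.
Qed.

End modulus_bounds.

Theorem theorem4p6 (d : measure_display) (T : measurableType d) (R : realType)
    (P : probability T R) (alpha kappa gamma : R)
    (N : seq bool -> {RV P >-> R}) (Z : T -> R -> R)
    (halpha : 0 < alpha <= 2^-1)
    (hkappa : kappa = 2^-1 `^ (2 - alpha))
    (hgamma : gamma = (4 - 2 * kappa) / (1 - kappa))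
    (hNnormal : forall w, standard_normal (N w))
    (hNindep : mutually_independent N)
    (hZ : is_limit_process alpha N Z) :
  {ae P, forall x,
    let L := limf_esup (modulus_ratio kappa (Z x)) (kappa_powers_to_0 kappa) in
    ((Num.sqrt (2 * gamma * ln 2 / ln kappa^-1))%:E <= L)%E /\
    (L <= (2 * Num.sqrt (2 * ln 2) /
            (Num.sqrt (ln kappa^-1) * (1 - Num.sqrt kappa)))%:E)%E}.
Proof.
have ln2 : 0 < ln 2 :> R by rewrite ln_gt0// ltr1n.
pose a : R := 2^-1 `^ (1 - alpha / 2).
have /andP[al0 al1] := halpha.
have a0 : 0 < a by rewrite powR_gt0.
have a1 : a < 1.
  rewrite /a /powR invr_eq0 pnatr_eq0/= expR_lt1 lnV ?posrE// mulrN oppr_lt0.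
  by rewrite mulr_gt0//; lra.
have a01 : 0 < a < 1 by rewrite a0.
have kE : kappa = a ^+ 2.
  by rewrite hkappa -powR_mulrn ?(ltW a0)// -powRrM; congr powR; lra.
have k0 : 0 < kappa by rewrite kE exprn_gt0.
have k1 : kappa < 1 by rewrite kE exprn_ilt1// ltW.
have nk0 : 1 - kappa != 0 by rewrite subr_eq0 gt_eqF.
(* The partial sums of [gamma = 4 + 2 * (kappa + kappa ^+ 2 + ...)]. *)
pose gm m : R := 4 + 2 * \sum_(j < m) (a ^+ 2) ^+ j.+1.
have gmE m : gm m = gamma - 2 * kappa / (1 - kappa) * kappa ^+ m.
  have : (1 - kappa) * \sum_(j < m) kappa ^+ j = 1 - kappa ^+ m.
    by rewrite -[1 - kappa]opprB mulNr -subrX1 opprB.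
  set s := \sum_(j < m) _ => sE.
  rewrite /gm -kE hgamma; under eq_bigr do rewrite exprS.
  rewrite -mulr_sumr -/s.
  have -> : kappa ^+ m = 1 - (1 - kappa) * s by rewrite sE; ring.
  by field.
have gm_lt m : gm m < gamma.
  by rewrite gmE ltrBlDr ltrDl !mulr_gt0// ?invr_gt0 ?subr_gt0 ?exprn_gt0.
have gamma0 : 0 < gamma.
  by have := gm_lt 0%N; rewrite /gm big_ord0; lra.
have gm_cvg : gm @ \oo --> gamma.
  rewrite (_ : gm =
      fun m => gamma - 2 * kappa / (1 - kappa) * kappa ^+ m); last exact/funext.
  rewrite -[gamma in X in _ --> X]subr0; apply: cvgB; first exact: cvg_cst.
  rewrite -(mulr0 (2 * kappa / (1 - kappa))); apply: cvgM; first exact: cvg_cst.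
  by apply: cvg_expr; rewrite gtr0_norm.
(* The critical value, with [gamma * b ^+ 2 / 2 = ln 2]; as [gm m < gamma], every truncation stays
   strictly below [ln 2]. *)
pose b := Num.sqrt (2 * ln 2 / gamma).
have b2 : b ^+ 2 = 2 * ln 2 / gamma.
  by rewrite sqr_sqrtr// !mulr_ge0// ?invr_ge0 ltW.
(* Any [c ^+ 2] above [2 * ln 2] makes [2 * expR (- c ^+ 2 / 2) < 1]. *)
pose c p : R := Num.sqrt (2 * ln 2 * (1 + p.+1%:R^-1)).
have upper : {ae P, forall x, forall p, exists K, forall w, (K <= size w)%N ->
    `|N w x| <= c p * Num.sqrt (size w)%:R}.
  apply: ae_foralln => p; apply: ae_eventually_le_sqrt_size => //.
    exact: sqrtr_ge0.
  have p0 : 0 < p.+1%:R^-1 :> R by rewrite invr_gt0.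
  rewrite sqr_sqrtr; last by rewrite !mulr_ge0// ?addr_ge0// ltW.
  rewrite -[X in X * expR _](@lnK _ 2) ?posrE// -expRD expR_lt1.
  rewrite (_ : _ + _ = - (ln 2 * p.+1%:R^-1)); last by field.
  by rewrite oppr_lt0 mulr_gt0.
have lower : {ae P, forall x, forall m n0, exists2 n, (n0 <= n)%N &
    exists2 w, size w = n &
    [/\ 2 * (b * Num.sqrt n%:R) <= N w x,
        forall j, (j < m)%N ->
          a ^+ j.+1 * (b * Num.sqrt n%:R) <= N (w ++ false :: nseq j false) x &
        forall j, (j < m)%N ->
          N (w ++ true :: nseq j false) x <= - (a ^+ j.+1 * (b * Num.sqrt n%:R))]}.
  apply: ae_foralln => m; apply: (ae_frequently_block (ltW a0) hNnormal hNindep).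
    exact: sqrtr_ge0.
  rewrite b2 -/(gm m) (_ : _ / 2 = gm m / gamma * ln 2); last first.
    by field; rewrite gt_eqF.
  by rewrite gtr_pMl// ltr_pdivrMr// mul1r.
have walkZ := limit_process_walk hZ.
move: upper lower walkZ; apply: filterS3 => x up low walkZ.
rewrite kE; split.
  have := limf_esup_modulus_ge a01 walkZ (sqrtr_ge0 _) (up 0%N) low gm_cvg.
  apply: le_trans; rewrite lee_fin -kE.
  rewrite sqrtrM ?mulr_ge0 ?(ltW gamma0) ?(ltW ln2)// sqrtrV; last first.
    by rewrite ln_ge0// invf_ge1// ltW.
  (* Thus [b * gamma] is the square root of [2 * gamma * ln 2]. *)
  rewrite (_ : 2 * gamma * ln 2 = b ^+ 2 * gamma ^+ 2); last first.
    by rewrite b2; field; rewrite gt_eqF.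
  by rewrite -exprMn sqrtr_sqr ger0_norm// mulr_ge0 ?sqrtr_ge0// ltW.
have := limf_esup_modulus_le a01 walkZ up.
by rewrite sqrtr_sqr gtr0_norm.
Qed.
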